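(* Let $\mathcal{N}=(\mathcal{G},P)$ be a network with cell graph $\mathcal{G}=(\mathcal{V},\mathcal{E})$ on $n$ vertices and $P=\prod_{v\in\mathcal{V}}\mathbb{R}^k$, $k\ge 1$. If $\mathcal{N}$ is an all-to-all coupling network (every two distinct vertices of $\mathcal{G}$ are joined by an edge), then the admissible functions of $\mathcal{N}$ are exactly the $\mathbf{S}_n$-invariant smooth functions $f:P\to\mathbb{R}$. Otherwise, a smooth function $f:P\to\mathbb{R}$ is an admissible function of $\mathcal{N}$ if and only if there exist smooth functions $\alpha_{d(v)}:\mathbb{R}^k\to\mathbb{R}$ (and, in case 1, $\gamma_{d(v)}:\mathbb{R}^k\to\mathbb{R}$), depending on the vertex $v$ only through its degree $d(v)$, and a smooth function $\beta:\mathbb{R}^{2k}\to\mathbb{R}$ such that one of the following holds: 1. $\mathcal{G}$ is bipartite and, for the bipartition $\mathcal{V}=\mathcal{V}_1\,\dot\cup\,\mathcal{V}_2$, $$f(x)=\sum_{e\in\mathcal{E},\ \rho(e)\in\mathcal{V}_i}\beta(x_{\rho(e)},x_{\tau(e)})+\sum_{v\in\mathcal{V}_1}\alpha_{d(v)}(x_v)+\sum_{v\in\mathcal{V}_2}\gamma_{d(v)}(x_v),$$ where $i=1$ or $2$ (every edge is oriented so that its head $\rho(e)$ lies in $\mathcal{V}_i$). In addition, if there exist $v_1\in\mathcal{V}_1$ and $v_2\in\mathcal{V}_2$ with $d(v_1)=d(v_2)$, then $\beta$ is $\mathbf{Z}_2$-invariant and $$f(x)=\sum_{e\in\mathcal{E}}\beta(x_{\rho(e)},x_{\tau(e)})+\sum_{v\in\mathcal{V}}\alpha_{d(v)}(x_v).$$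 2. $\mathcal{G}$ is not bipartite and $$f(x)=\sum_{e\in\mathcal{E}}\beta(x_{\rho(e)},x_{\tau(e)})+\sum_{v\in\mathcal{V}}\alpha_{d(v)}(x_v)$$ with $\beta$ $\mathbf{Z}_2$-invariant.
   Context: A cell graph $\mathcal{G}=(\mathcal{V},\mathcal{E})$ is a finite connected undirected graph without multiple edges. Internal edges (loops) are disregarded: $\mathcal{E}$ denotes the set of edges joining two distinct vertices. For $v\in\mathcal{V}$, the input set $I(v)$ is the set of vertices $u\ne v$ with $(u,v)\in\mathcal{E}$, and $d(v)=|I(v)|$ is the degree of $v$. The network is $\mathcal{N}=(\mathcal{G},P)$ with configuration space $P=\prod_{v\in\mathcal{V}}P_v$, $P_v=\mathbb{R}^k$ with coordinates $x_v=(x_v^1,\dots,x_v^k)$; all cells and all edges are of the same type. A smooth function $f:P\to\mathbb{R}$ is an admissible function if its gradient is an admissible vector field, i.e. for each degree $d$ occurring in $\mathcal{G}$ there is a function $\tilde f_d$ such that for every $v\in\mathcal{V}$ with $I(v)=\{u_1,\dots,u_{d(v)}\}$, $$\frac{\partial f}{\partial x_v}(x)=\tilde f_{d(v)}(x_v,\overline{x_{u_1},\dots,x_{u_{d(v)}}}),$$ where the over-bar means that $\tilde f_{d(v)}$ is invariant under all permutations of the variables $x_{u_1},\dots,x_{u_{d(v)}}$ (here $\partial f/\partial x_v=(\partial f/\partial x_v^1,\dots,\partial f/\partial x_v^k)$). In particular vertices of the same degree have the same function $\tilde f_d$. For each edge $e$ joining $v_1\neq v_2$, $\rho(e),\tau(e)$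 denote its two endpoints in a chosen order (''head'' $\rho(e)$ and ''tail'' $\tau(e)$), $\{\rho(e),\tau(e)\}=\{v_1,v_2\}$. $\mathbf{S}_n$ acts on $(\mathbb{R}^k)^n$ by permuting the $n$ variables $x_v$. A function $\beta:\mathbb{R}^{k}\times\mathbb{R}^k\to\mathbb{R}$ is $\mathbf{Z}_2$-invariant if $\beta(x,y)=\beta(y,x)$ for all $x,y\in\mathbb{R}^k$. *)

(* Defs.v *)
From HB Require Import structures.
From mathcomp Require Import all_boot all_order all_algebra all_fingroup.
From mathcomp Require Import all_classical all_reals all_analysis.

Set Implicit Arguments.
Unset Strict Implicit.
Unset Printing Implicit Defensive.

Import Order.TTheory GRing.Theory Num.Theory.
Import numFieldNormedType.Exports.

Local Open Scope ring_scope.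

Section Smooth.
Variables (R : realType) (E : normedModType R).

(* Class C^m by iterated directional derivatives. It is used here only for
   finite-dimensional E, where, for continuous derivatives, this agrees with
   Frechet differentiability of every order. *)
Fixpoint class_C (m : nat) (f : E -> R) : Prop :=
  continuous f /\
  if m is m'.+1 then
    forall v : E, (forall x, derivable f x v) /\ class_C m' (fun x => 'D_v f x)
  else True.

Definition smooth (f : E -> R) : Prop := forall m, class_C m f.

End Smooth.

(* A cell graph is given by the relation [adj] joining distinct vertices; loops
   are disregarded, so [adj] is irreflexive. *)
Section CellGraph.
Variables (V : finType) (adj : rel V).

Definition cell_graph : Prop :=
  [/\ (0 < #|V|)%N, symmetric adj, irreflexive adj
    & forall u v, connect adj u v].

Definition input_set (v : V) : {set V} := [set u | adj u v].

Definition degree (v : V) : nat := #|input_set v|.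

Definition edges : {set {set V}} :=
  [set [set p.1; p.2] | p : V * V & adj p.1 p.2].

Definition all_to_all : Prop := forall u v, u != v -> adj u v.

Definition bipartition (V1 V2 : {set V}) : Prop :=
  [/\ V1 :|: V2 = [set: V], [disjoint V1 & V2]
    & forall u v, adj u v ->
        (u \in V1 /\ v \in V2) \/ (u \in V2 /\ v \in V1)].

Definition bipartite : Prop := exists V1 V2, bipartition V1 V2.

(* The values of [rho] and [tau] outside [edges] are irrelevant. *)
Definition orientation (rho tau : {set V} -> V) : Prop :=
  forall e, e \in edges -> [set rho e; tau e] = e.

End CellGraph.

Section Network.
Variables (R : realType) (V : finType) (k : nat).

(* A configuration is a matrix whose rows are the states of the cells, the
   vertices being numbered by [enum_rank]. *)
Definition config := 'M[R]_(#|V|, k).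

Definition cell (x : config) (v : V) : 'rV[R]_k := row (enum_rank v) x.

Definition gradient (f : config -> R) (x : config) : config :=
  \matrix_(i, j) 'D_(delta_mx i j) f x.

(* The second argument of [ft d] lists, as rows, the states of the d inputs. *)
Definition admissible_vector_field (adj : rel V) (X : config -> config) : Prop :=
  exists ft : forall d, 'rV[R]_k -> 'M[R]_(d, k) -> 'rV[R]_k,
    (forall d (s : 'S_d) y Y, ft d y (row_perm s Y) = ft d y Y) /\
    (forall (v : V) (u : 'I_(degree adj v) -> V),
       injective u -> [set u i | i : 'I_(degree adj v)] = input_set adj v ->
       forall x, cell (X x) v =
         ft (degree adj v) (cell x v)
            (\matrix_(i < degree adj v) cell x (u i))).

Definition admissible_function (adj : rel V) (f : config -> R) : Prop :=
  smooth f /\ admissible_vector_field adj (gradient f).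

Definition S_invariant (f : config -> R) : Prop :=
  forall (s : 'S_#|V|) x, f (row_perm s x) = f x.

Definition Z2_invariant (beta : 'rV[R]_k * 'rV[R]_k -> R) : Prop :=
  forall x y, beta (x, y) = beta (y, x).

End Network.

(* Main.v *)
Require Import Defs.
From HB Require Import structures.
From mathcomp Require Import all_boot all_order all_algebra all_fingroup.
From mathcomp Require Import all_classical all_reals all_analysis.
From mathcomp Require Import ring.

Set Implicit Arguments.
Unset Strict Implicit.
Unset Printing Implicit Defensive.

Import Order.TTheory GRing.Theory Num.Theory.
Import numFieldNormedType.Exports.

Local Open Scope ring_scope.

(** The gradient of f at the cell v, along the coordinates of v only, records
    the increments f (x[v := a]) - f (x[v := b]), and conversely. So for smooth
    f admissibility is a statement about finite differences
    ([admissible_local_differences], [local_differences_admissible]): the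
    increment at v depends only on a, b and the multiset of the states of the
    inputs of v, in the same way for all cells with that number of inputs. All
    that follows is combinatorics of such increments; calculus returns only to
    see that the summands obtained are smooth, as they are combinations of f
    composed with affine maps.

    For a complete graph, comparing the increments at two cells shows that
    exchanging their states leaves f unchanged, and transpositions generate the
    symmetric group.

    For a connected graph that is not complete, the key point is that f has no
    three-body interaction: the third mixed difference of f at three distinct
    cells vanishes. If two of them are not joined this is locality. If u1, u2
    are inputs of v, the symmetry of the increment at v in its inputs lets one
    replace u1, u2 by any other two inputs of v; two inputs of v that are not
    joined would do. If there are none, then v and its inputs form a clique,
    and some input w of v has an input outside that clique ([clique_exit]); so
    w does have two inputs that are not joined, hence the third differences at
    w vanish, in particular the one at w, v and another input of v, and this is
    also a third difference at v ([flat_inputs]).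

    Hence f is a constant plus terms in one cell plus an interaction term for
    each edge ([pair_decomposition]), where the term of a cell and the
    interaction seen from a cell depend only on its degree. The interaction
    seen from the other end of an edge is the same function with its arguments
    exchanged, so along walks it alternates between a function and its
    transpose. If it is not symmetric, the two values it takes split the
    vertices into a bipartition, which proves the symmetry of beta for graphs
    that are not bipartite ([reversible_nonbipartite]); two cells of equal
    degree in different parts force it too. The converse is the computation of
    the increments of a sum over edges ([pair_form_diff]). *)

(** * Smoothness and affine maps *)

Section AffineComposition.
Variables (R : realType) (E F : normedModType R).

(** L is the linear part of A; this form makes the difference quotients of f \o
    A literally those of f. *)
Definition affine_along (A : E -> F) (L : E -> F) : Prop :=
  forall (h : R) v x, A (h *: v + x) = h *: L v + A x.

Lemma affine_diff_quotient (A L : E -> F) (f : F -> R) (x v : E) :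
  affine_along A L ->
  (fun h : R => h^-1 *: (((f \o A) \o shift x) (h *: v) - (f \o A) x)) =
  (fun h : R => h^-1 *: ((f \o shift (A x)) (h *: L v) - f (A x))).
Proof. by move=> AL; apply/funext => h /=; rewrite AL. Qed.

Lemma derivable_affine (A L : E -> F) (f : F -> R) (x v : E) :
  affine_along A L -> derivable f (A x) (L v) -> derivable (f \o A) x v.
Proof. by move=> AL; rewrite /derivable (affine_diff_quotient _ _ _ AL). Qed.

Lemma derive_affine (A L : E -> F) (f : F -> R) (x v : E) :
  affine_along A L -> 'D_v (f \o A) x = 'D_(L v) f (A x).
Proof. by move=> AL; rewrite /derive (affine_diff_quotient _ _ _ AL). Qed.

Lemma derive_increments (f g : E -> R) (d x : E) :
  (forall y z, f y - f z = g y - g z) -> 'D_d f x = 'D_d g x.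
Proof.
move=> fg; rewrite /derive.
have -> // : (fun h : R => h^-1 *: ((f \o shift x) (h *: d) - f x)) =
             (fun h : R => h^-1 *: ((g \o shift x) (h *: d) - g x)).
by apply/funext => h /=; rewrite fg.
Qed.

Lemma class_C_affine (A L : E -> F) m (f : F -> R) :
  continuous A -> affine_along A L -> class_C m f -> class_C m (f \o A).
Proof.
move=> cA AL; elim: m f => [|m IH] f /= [cf Hf]; split=> //;
  try by move=> x; apply: continuous_comp; [exact: cA|exact: cf].
move=> v; have [df Cf] := Hf (L v); split=> [x|].
  exact: (derivable_affine AL).
rewrite (_ : (fun x => _) = (fun y => 'D_(L v) f y) \o A); first exact: IH.
by apply/funext => x; rewrite (derive_affine _ _ _ AL).
Qed.

Definition continuous_affine (A : E -> F) : Prop :=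
  continuous A /\ exists L, affine_along A L.

Lemma smooth_affine (A : E -> F) (f : F -> R) :
  continuous_affine A -> smooth f -> smooth (f \o A).
Proof. by move=> [cA [L AL]] sf m; exact: class_C_affine AL _. Qed.

Lemma class_C_comb m (c : R) (f g : E -> R) :
  class_C m f -> class_C m g -> class_C m (fun x => f x + c * g x).
Proof.
elim: m f g => [|m IH] f g /= [cf Hf] [cg Hg]; split=> //;
  try by move=> x; apply: cvgD;
    [exact: cf|apply: cvgM; [exact: cvg_cst|exact: cg]].
move=> v; have [df Cf] := Hf v; have [dg Cg] := Hg v; split=> [x|].
  by apply: derivableD => //; exact: (derivableZ (k := c)).
rewrite (_ : (fun x => _) = (fun x => 'D_v f x + c * 'D_v g x)).
  exact: IH.
apply/funext => x; rewrite [LHS](deriveD (df x) (derivableZ (dg x))).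
by rewrite deriveZ.
Qed.

Lemma class_C_cst m (c : R) : class_C m (fun _ : E => c).
Proof.
elim: m c => [|m IH] c; split=> //; try exact: cst_continuous.
move=> v; split=> [x|]; first exact: derivable_cst.
have -> : (fun x => 'D_v (fun _ : E => c) x) = (fun _ => 0).
  by apply/funext => x; exact: derive_cst.
exact: IH.
Qed.

Lemma smoothD (f g : E -> R) :
  smooth f -> smooth g -> smooth (fun x => f x + g x).
Proof.
move=> sf sg m; rewrite (_ : (fun x => _) = (fun x => f x + 1 * g x)).
  exact: class_C_comb.
by apply/funext => x; rewrite mul1r.
Qed.

Lemma smoothB (f g : E -> R) :
  smooth f -> smooth g -> smooth (fun x => f x - g x).
Proof.
move=> sf sg m; rewrite (_ : (fun x => _) = (fun x => f x + (-1) * g x)).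
  exact: class_C_comb.
by apply/funext => x; rewrite mulN1r.
Qed.

Lemma smooth_cst (c : R) : smooth (fun _ : E => c).
Proof. by move=> m; exact: class_C_cst. Qed.

End AffineComposition.

(** On a line of direction d this is the mean value theorem in one variable; a
    path along coordinate directions then joins any two points. *)
Lemma derive_eq0_line (R : realType) (E : normedModType R)
    (f : E -> R) (d : E) :
  (forall x, is_derive x d f 0) -> forall (t : R) x, f (t *: d + x) = f x.
Proof.
move=> f0 t x; pose A (s : R) := s *: d + x.
have AL : affine_along (E := R) A (fun s : R => s *: d).
  by move=> h v y; rewrite /A scalerDl scalerA addrA.
have := @is_derive_0_is_cst R (f \o A) t 0.
rewrite /A /= scale0r add0r; apply=> s.
have [df Df] := f0 (A s).
split; first by apply: (derivable_affine AL); rewrite scale1r.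
by rewrite (derive_affine _ _ _ AL) scale1r.
Qed.

(** Invariance under each c i separately gives invariance under sums: this is
    how information on one coordinate, or on one cell, at a time is put
    together. *)
Lemma sum_shift_invariant (M : zmodType) (T : Type) (F : M -> T) (I : Type)
    (c : I -> M) :
  (forall i x, F (c i + x) = F x) ->
  forall r x, F (\sum_(i <- r) c i + x) = F x.
Proof.
move=> Fc; elim=> [|i r IH] x; first by rewrite big_nil add0r.
by rewrite big_cons -addrA Fc IH.
Qed.

Lemma partials_eq0_cst (R : realType) (k : nat) (f : 'rV[R]_k -> R) :
  (forall j x, is_derive x (delta_mx 0 j) f 0) -> forall a b, f a = f b.
Proof.
move=> f0 a b; rewrite -(subrK b a) [X in f (X + _)]row_sum_delta.
by apply: sum_shift_invariant => j y; exact: derive_eq0_line.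
Qed.

(** * Changing the state of one cell *)

Section Configurations.
Variables (R : realType) (V : finType) (k : nat).
Implicit Types (x y : config R V k) (a b : 'rV[R]_k) (u v w : V).

Definition of_cells (g : V -> 'rV[R]_k) : config R V k :=
  \matrix_(i, j) g (enum_val i) 0 j.

Lemma cell_of_cells g v : cell (of_cells g) v = g v.
Proof. by apply/rowP => j; rewrite !mxE enum_rankK. Qed.

Lemma eq_cells x y : cell x =1 cell y -> x = y.
Proof.
move=> xy; apply/matrixP => i j.
have := congr1 (fun r : 'rV[R]_k => r 0 j) (xy (enum_val i)).
by rewrite !mxE enum_valK.
Qed.

Lemma cell0 v : cell (0 : config R V k) v = 0.
Proof. by apply/rowP => j; rewrite !mxE. Qed.

Lemma cellD x y v : cell (x + y) v = cell x v + cell y v.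
Proof. by apply/rowP => j; rewrite !mxE. Qed.

Lemma cellZ (h : R) x v : cell (h *: x) v = h *: cell x v.
Proof. by apply/rowP => j; rewrite !mxE. Qed.

Definition upd x v a := of_cells (fun u => if u == v then a else cell x u).

Lemma cell_upd x v a u : cell (upd x v a) u = if u == v then a else cell x u.
Proof. exact: cell_of_cells. Qed.

Lemma cell_upd_eq x v a : cell (upd x v a) v = a.
Proof. by rewrite cell_upd eqxx. Qed.

Lemma cell_upd_neq x v a u : u != v -> cell (upd x v a) u = cell x u.
Proof. by rewrite cell_upd => /negbTE ->. Qed.

Lemma upd_id x v : upd x v (cell x v) = x.
Proof. by apply: eq_cells => u; rewrite cell_upd; case: (u =P v) => [->|]. Qed.

Lemma upd_upd x v a b : upd (upd x v a) v b = upd x v b.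
Proof. by apply: eq_cells => u; rewrite !cell_upd; case: (u == v). Qed.

Lemma updC x u v a b : u != v -> upd (upd x u a) v b = upd (upd x v b) u a.
Proof.
move=> uv; apply: eq_cells => w; rewrite !cell_upd; case: (w =P v) => // ->.
by rewrite eq_sym (negbTE uv).
Qed.

(** Updating is affine in the configuration and the new state jointly, so
    nested updates, which enter the second differences of f, are covered as
    well. *)
Lemma affine_upd2 (E : normedModType R) (A L : E -> config R V k)
    (B M : E -> 'rV[R]_k) v : affine_along A L -> affine_along B M ->
  affine_along (fun p => upd (A p) v (B p)) (fun p => upd (L p) v (M p)).
Proof.
move=> AL BM h d p; apply: eq_cells => u.
by rewrite AL BM cellD cellZ !cell_upd cellD cellZ; case: (u == v).
Qed.

Lemma continuous_upd2 (E : normedModType R) (A : E -> config R V k)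
    (B : E -> 'rV[R]_k) v : continuous A -> continuous B ->
  continuous (fun p => upd (A p) v (B p)).
Proof.
move=> cA cB p W /nbhs_ballP[e e0 eW].
have nA : nbhs p (fun q => ball (A p) e (A q)) by apply: cA; exact: nbhsx_ballx.
have nB : nbhs p (fun q => ball (B p) e (B q)) by apply: cB; exact: nbhsx_ballx.
apply: filterS2 nA nB => q [_ Aq] [_ Bq]; apply: eW; split=> // i j.
by rewrite !mxE; case: ifP => _; [exact: Bq|rewrite !mxE; exact: Aq].
Qed.

Lemma affine_cst (E F : normedModType R) (y : F) :
  affine_along (fun _ : E => y) (fun _ => 0).
Proof. by move=> h d p; rewrite scaler0 add0r. Qed.

Lemma continuous_affine_cst (E F : normedModType R) (y : F) :
  continuous_affine (fun _ : E => y).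
Proof.
split; first exact: cst_continuous.
by exists (fun=> 0); exact: affine_cst.
Qed.

Lemma continuous_affine_upd (E : normedModType R) (A : E -> config R V k)
    (B : E -> 'rV[R]_k) v : continuous_affine A -> continuous_affine B ->
  continuous_affine (fun p => upd (A p) v (B p)).
Proof.
move=> [cA [L AL]] [cB [M BM]]; split; first exact: continuous_upd2.
by exists (fun p => upd (L p) v (M p)); exact: affine_upd2.
Qed.

Lemma affine_upd x v : affine_along (upd x v) (upd 0 v).
Proof. by apply: affine_upd2; [exact: affine_cst|]. Qed.

Lemma delta_mx_upd v j :
  delta_mx (enum_rank v) j = upd 0 v (delta_mx 0 j) :> config R V k.
Proof.
apply: eq_cells => u; rewrite cell_upd; apply/rowP => l; rewrite !mxE.
rewrite (inj_eq enum_rank_inj).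
by case: (u == v); rewrite !mxE ?eqxx.
Qed.

(** The part of the gradient at v is the derivative of f restricted to the
    states of v, which ties it to the increments of f at v. *)
Lemma cell_gradient (f : config R V k -> R) x v a j :
  cell (gradient f (upd x v a)) v 0 j = 'D_(delta_mx 0 j) (f \o upd x v) a.
Proof.
by rewrite !mxE (derive_affine _ _ _ (@affine_upd x v)) delta_mx_upd.
Qed.

(** Every configuration is a sum of configurations supported on one cell. *)
Lemma eq_upd_cst (f : config R V k -> R) :
  (forall v x a, f (upd x v a) = f (upd x v 0)) -> forall x, f x = f 0.
Proof.
move=> f0 x.
have -> : x = \sum_(v <- enum V) upd 0 v (cell x v) + 0.
  apply: eq_cells => u; rewrite cellD cell0 addr0.
  have -> : cell (\sum_(v <- enum V) upd 0 v (cell x v)) u =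
      \sum_(v <- enum V) cell (upd 0 v (cell x v)) u.
    elim: (enum V) => [|v s IH]; first by rewrite !big_nil cell0.
    by rewrite !big_cons cellD IH.
  rewrite big_enum_cond /= (bigD1 u) //= cell_upd_eq big1 ?addr0 // => v vu.
  by rewrite cell_upd_neq 1?eq_sym // cell0.
apply: sum_shift_invariant => v y.
have -> : upd 0 v (cell x v) + y = upd y v (cell x v + cell y v).
  apply: eq_cells => u; rewrite cellD !cell_upd.
  by case: eqP => [->|]; rewrite ?cell0 ?add0r.
by rewrite f0 -{2}(upd_id y v) [RHS]f0.
Qed.

End Configurations.

(** * Admissibility as a condition on finite differences *)

Section LocalDifferences.
Variables (R : realType) (V : finType) (adj : rel V) (k : nat).
Implicit Types (x y : config R V k) (a b : 'rV[R]_k) (u v w : V).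
Implicit Types (f : config R V k -> R).

Definition inputs x v : seq 'rV[R]_k :=
  [seq cell x u | u <- enum (input_set adj v)].

(** The finite-difference form of admissibility. Comparing multisets of input
    states avoids both the dependent type of the vector field and the choice of
    a numbering of the inputs; cells with matching inputs have equal
    degrees. *)
Definition local_differences f : Prop := forall v w x y,
  perm_eq (inputs x v) (inputs y w) ->
  forall a b, f (upd x v a) - f (upd x v b) = f (upd y w a) - f (upd y w b).

Lemma size_inputs x v : size (inputs x v) = degree adj v.
Proof. by rewrite size_map -cardE. Qed.

Definition enumerates d v (u : 'I_d -> V) : Prop :=
  injective u /\ [set u i | i : 'I_d] = input_set adj v.

Lemma inputs_enumerates d v (u : 'I_d -> V) x : enumerates v u ->
  perm_eq (inputs x v) [seq cell x (u i) | i <- enum 'I_d].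
Proof.
move=> [uI uE]; rewrite /inputs (map_comp (cell x) u); apply: perm_map.
apply: uniq_perm => [||w]; first exact: enum_uniq.
  by rewrite (map_inj_uniq uI); exact: enum_uniq.
rewrite mem_enum -uE; apply/imsetP/mapP => [[i _ ->]|[i _ ->]];
  by exists i; rewrite ?mem_enum.
Qed.

Lemma degree_enumerates d v (u : 'I_d -> V) :
  enumerates v u -> degree adj v = d.
Proof. by case=> uI uE; rewrite /degree -uE card_imset // card_ord. Qed.

(** The numbering of the inputs of w is adapted to that of v, so that the two
    matrices of input states become equal. *)
Lemma match_enumerations v w x y : perm_eq (inputs x v) (inputs y w) ->
  exists d (u u' : 'I_d -> V),
    [/\ enumerates v u, enumerates w u'
      & forall i, cell x (u i) = cell y (u' i)].
Proof.
move=> E; have dE : degree adj w = degree adj v.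
  by rewrite -(size_inputs x v) -(size_inputs y w) (perm_size E).
pose u (i : 'I_(degree adj v)) := enum_val i.
pose u' (i : 'I_(degree adj v)) : V := enum_val (cast_ord (esym dE) i).
have en v' : enumerates v' (fun i : 'I_(degree adj v') => enum_val i).
  split=> [i j /enum_val_inj //|]; apply/setP => z.
  apply/imsetP/idP => [[i _ ->]|zI]; first exact: enum_valP.
  by exists (enum_rank_in zI z); rewrite // enum_rankK_in.
have enu' : enumerates w u'.
  case: (en w) => wI wE; split=> [i j /wI /cast_ord_inj //|].
  rewrite -wE; apply/setP => z; apply/imsetP/imsetP => [[i _ ->]|[i _ ->]].
    by exists (cast_ord (esym dE) i).
  by exists (cast_ord dE i); rewrite // /u' cast_ordK.
pose t1 : (degree adj v).-tuple _ := [tuple cell x (u i) | i < degree adj v].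
pose t2 : (degree adj v).-tuple _ := [tuple cell y (u' i) | i < degree adj v].
have /tuple_permP[s sE] : perm_eq t1 t2.
  rewrite /= -(permPl (inputs_enumerates x (en v))).
  by rewrite (permPl E) (permPl (inputs_enumerates y enu')).
exists (degree adj v), u, (u' \o s); split=> // [|i].
  case: enu' => uI uE; split; first by apply: inj_comp => //; exact: perm_inj.
  rewrite -uE; apply/setP => z; apply/imsetP/imsetP => [[i _ ->]|[i _ ->]].
    by exists (s i).
  by exists ((s^-1)%g i); rewrite //= permKV.
have := congr1 (fun r => nth 0 r i) sE; rewrite -!tnth_nth !tnth_mktuple.
by [].
Qed.

Lemma row_row_perm d (s : 'S_d) (Y : 'M[R]_(d, k)) i :
  row i (row_perm s Y) = row (s i) Y.
Proof. by apply/rowP => j; rewrite !mxE. Qed.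

(** The restrictions of f to the states of v and of w have the same gradient,
    so they differ by a constant. The inputs of a cell are unaffected by its
    own state because no cell is joined to itself. *)
Lemma admissible_local_differences f :
  irreflexive adj -> admissible_function adj f -> local_differences f.
Proof.
move=> irr [sf [ft [_ ftE]]] v w x y E a b.
have [d [u [u' [eu eu' uu']]]] := match_enumerations E.
have {}ftE w' (u1 : 'I_d -> V) z : enumerates w' u1 ->
    cell (gradient f z) w' = ft d (cell z w') (\matrix_(i < d) cell z (u1 i)).
  move=> eu1; have dE := degree_enumerates eu1; subst d.
  by case: eu1 => u1I u1E; exact: ftE.
have neq w' (u1 : 'I_d -> V) i : enumerates w' u1 -> u1 i != w'.
  case=> _ u1E; have : u1 i \in input_set adj w' by rewrite -u1E imset_f.
  by rewrite inE; apply: contraTneq => ->; rewrite irr.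
have gradE c :
    cell (gradient f (upd x v c)) v = cell (gradient f (upd y w c)) w.
  rewrite (ftE _ _ _ eu) (ftE _ _ _ eu') !cell_upd_eq; congr (ft d _ _).
  by apply/row_matrixP => i; rewrite !rowK !cell_upd_neq ?neq.
have D z w' c e : derivable (f \o upd z w') c e.
  apply: (derivable_affine (@affine_upd _ _ _ z w')).
  by have [_ /(_ (upd 0 w' e))[]] := sf 1%N.
have /(_ a b) : forall a b, ((f \o upd x v) - (f \o upd y w)) a
                          = ((f \o upd x v) - (f \o upd y w)) b.
  apply: partials_eq0_cst => j c; apply: (is_derive_eq
    (is_deriveB (derivableP (D x v c _)) (derivableP (D y w c _)))).
  by rewrite -!cell_gradient gradE subrr.
rewrite !fctE /= => /eqP; rewrite subr_eq => /eqP ->.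
by rewrite [LHS]addrC !addrA addNr add0r [LHS]addrC.
Qed.

(** The vector field is read off from the gradient at any cell and
    configuration that realise the given states; increments determine
    derivatives, so the value does not depend on that choice. *)
Lemma local_differences_admissible f :
  smooth f -> local_differences f -> admissible_function adj f.
Proof.
move=> sf LD; split=> //.
pose value d (c : 'rV[R]_k) (Y : 'M[R]_(d, k)) (z : 'rV[R]_k) :=
  exists v (u : 'I_d -> V) x,
    [/\ enumerates v u, cell x v = c, \matrix_(i < d) cell x (u i) = Y
      & cell (gradient f x) v = z].
have valueU d c Y z z' : value d c Y z -> value d c Y z' -> z = z'.
  move=> [v [u [x [eu <- xY <-]]]] [v' [u' [x' [eu' vv' xY' <-]]]].
  have E : perm_eq (inputs x v) (inputs x' v').
    rewrite (permPl (inputs_enumerates x eu)).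
    rewrite perm_sym (permPl (inputs_enumerates x' eu')) perm_sym.
    rewrite (_ : [seq cell x (u i) | i <- _]
               = [seq cell x' (u' i) | i <- enum 'I_d]) //.
    apply: eq_map => i; move/row_matrixP: xY => /(_ i); rewrite -xY' !rowK.
    by [].
  apply/rowP => j.
  have := cell_gradient f x v (cell x v) j; rewrite upd_id => ->.
  have := cell_gradient f x' v' (cell x' v') j; rewrite upd_id vv' => ->.
  by apply: derive_increments => a b; exact: LD.
have valueS d c (s : 'S_d) Y z : value d c Y z -> value d c (row_perm s Y) z.
  move=> [v [u [x [[uI uE] xy xY xz]]]]; exists v, (u \o s), x; split=> //.
    split; first by apply: inj_comp => //; exact: perm_inj.
    rewrite -uE; apply/setP => w; apply/imsetP/imsetP => [[i _ ->]|[i _ ->]].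
      by exists (s i).
    by exists ((s^-1)%g i); rewrite //= permKV.
  by apply/row_matrixP => i; rewrite rowK /= -xY row_row_perm rowK.
(* Arguments that no configuration realises get the default value 0. *)
exists (fun d c Y => xget 0 (value d c Y)); split=> [d s c Y|].
  congr xget; apply/seteqP; split=> z; last exact: valueS.
  move=> /(valueS _ _ (s^-1)%g); rewrite -row_permM mulVg row_perm1; exact.
move=> v u uI uE x.
have Rx : value _ (cell x v) (\matrix_(i < degree adj v) cell x (u i))
              (cell (gradient f x) v) by exists v, u, x.
apply: (valueU _ _ _ _ _ Rx).
exact: (xgetI 0 Rx).
Qed.

End LocalDifferences.

(** * All-to-all coupling and symmetric functions *)

Section SymmetricFunctions.
Variables (R : realType) (V : finType) (adj : rel V) (k : nat).
Implicit Types (x y : config R V k) (a b c : 'rV[R]_k) (u v w : V).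
Implicit Types (f : config R V k -> R).

Lemma perm_inputs (s : {perm V}) v w x y :
  (forall u, adj (s u) w = adj u v) ->
  (forall u, adj u v -> cell y (s u) = cell x u) ->
  perm_eq (inputs adj x v) (inputs adj y w).
Proof.
move=> sE xy.
have -> : inputs adj x v = [seq cell y u | u <- map s (enum (input_set adj v))].
  rewrite -map_comp; apply/eq_in_map => u.
  by rewrite mem_enum inE => /xy /= ->.
apply/perm_map/uniq_perm => [||u].
- by rewrite (map_inj_uniq (@perm_inj _ s)); exact: enum_uniq.
- exact: enum_uniq.
rewrite mem_enum inE -[u](permKV s) (mem_map (@perm_inj _ s)) sE.
by rewrite mem_enum inE.
Qed.

Lemma S_invariant_perm_eq f x y : S_invariant f ->
  perm_eq [seq cell x v | v <- enum V] [seq cell y v | v <- enum V] ->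
  f x = f y.
Proof.
move=> Sf.
have rows (z : config R V k) : perm_eq [seq cell z v | v <- enum V]
                      [tuple row i z | i < #|V|].
  rewrite /= (map_comp (fun i => row i z) enum_rank); apply: perm_map.
  apply: uniq_perm => [||i].
  - by rewrite (map_inj_uniq enum_rank_inj); exact: enum_uniq.
  - exact: enum_uniq.
  by rewrite -[i]enum_valK (mem_map enum_rank_inj) !mem_enum.
rewrite (permPl (rows x)) perm_sym (permPl (rows y)) perm_sym.
move=> /tuple_permP[s sE].
have -> : x = row_perm s y; last by rewrite Sf.
apply/row_matrixP => i; rewrite row_row_perm.
by have := congr1 (fun r => nth 0 r i) sE; rewrite -!tnth_nth !tnth_mktuple.
Qed.

Hypotheses (irr : irreflexive adj) (complete : all_to_all adj).

Let adj_neq u v : adj u v = (u != v).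
Proof. by case: (eqVneq u v) => [->|/complete //]; rewrite irr. Qed.

(** In a complete graph v and its inputs are all the cells: this is what makes
    symmetric functions the local ones. *)
Lemma cells_upd_complete x v a :
  perm_eq [seq cell (upd x v a) u | u <- enum V] (a :: inputs adj x v).
Proof.
rewrite -{2}(cell_upd_eq x v a).
have -> : inputs adj x v = inputs adj (upd x v a) v.
  by apply/eq_in_map => u; rewrite mem_enum inE adj_neq => /cell_upd_neq ->.
rewrite -map_cons; apply/perm_map/uniq_perm => [||u]; first exact: enum_uniq.
  by rewrite /= enum_uniq mem_enum inE irr.
by rewrite inE !mem_enum !inE adj_neq; case: eqVneq.
Qed.

Lemma S_invariant_local_differences f :
  S_invariant f -> local_differences adj f.
Proof.
move=> Sf v w x y E a b.
have fE c : f (upd x v c) = f (upd y w c).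
  apply: S_invariant_perm_eq => //.
  rewrite (permPl (cells_upd_complete x v c)) perm_sym.
  by rewrite (permPl (cells_upd_complete y w c)) perm_cons perm_sym.
by rewrite !fE.
Qed.

(** With the other cells fixed, write g a c for f with v in state a and w in
    state c. Locality gives g a c - g b c = g c a - g c b; taking b = 0, and
    also b = c = 0, yields g a c = g c a. *)
Lemma local_differences_swap f v w x : local_differences adj f -> v != w ->
  f (upd (upd x v (cell x w)) w (cell x v)) = f x.
Proof.
move=> LD vw.
have key a b c : f (upd (upd x v a) w c) - f (upd (upd x v b) w c)
               = f (upd (upd x v c) w a) - f (upd (upd x v c) w b).
  rewrite ![upd (upd x v _) w c]updC //; apply: LD.
  apply: (@perm_inputs (tperm v w)) => u.
    by rewrite !adj_neq -(inj_eq (@perm_inj _ (tperm v w)) u v) tpermL.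
  rewrite adj_neq => uv; rewrite !cell_upd.
  case: tpermP uv => [->|->|]; rewrite ?eqxx //.
  by move=> /eqP/negbTE -> /eqP/negbTE ->.
have := key (cell x v) 0 (cell x w); rewrite !upd_id.
by rewrite (addIr _ (key (cell x w) 0 0)) => /addIr.
Qed.

Lemma local_differences_S_invariant f :
  local_differences adj f -> S_invariant f.
Proof.
move=> LD s; have [ts -> tsE] := prod_tpermP s.
elim: ts tsE => [|[i j] ts IH] /= tsE x; first by rewrite big_nil row_perm1.
case/andP: tsE => ij tsE; rewrite big_cons row_permM /= -[RHS](IH tsE).
set y := row_perm _ x.
have ij' : enum_val i != enum_val j by rewrite (inj_eq enum_val_inj).
rewrite -[RHS](local_differences_swap y LD ij').
congr f; apply: eq_cells => u; rewrite {1}/cell row_row_perm !cell_upd.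
rewrite -[u]enum_rankK !(inj_eq enum_val_inj) enum_valK /cell !enum_valK.
case: tpermP => [->|->|/eqP/negbTE -> /eqP/negbTE -> //]; rewrite ?eqxx //.
by rewrite (negbTE ij).
Qed.

End SymmetricFunctions.

(** * Sums of pair interactions over the edges *)

Section PairForm.
Variables (R : realType) (V : finType) (adj : rel V) (k : nat).
Variables (rho tau : {set V} -> V).
Implicit Types (x y : config R V k) (a b c : 'rV[R]_k) (u v w : V).

(** Q v a b is the interaction seen from v, in state a, with an input in state
    b; the dependence on v allows for a bipartite graph, where the two ends of
    an edge play different roles. *)
Definition pair_form (Q : V -> 'rV[R]_k -> 'rV[R]_k -> R)
    (P : V -> 'rV[R]_k -> R) x :=
  \sum_(e in edges adj) Q (rho e) (cell x (rho e)) (cell x (tau e))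
  + \sum_v P v (cell x v).

Definition reversible (Q : V -> 'rV[R]_k -> 'rV[R]_k -> R) :=
  forall u v a b, adj u v -> Q u a b = Q v b a.

Hypotheses (sym : symmetric adj) (irr : irreflexive adj)
  (ori : orientation adj rho tau).

Lemma edgesP e :
  reflect (exists u v, adj u v /\ e = [set u; v]) (e \in edges adj).
Proof.
apply: (iffP imsetP) => [[[u v] /= uv ->]|[u [v [uv ->]]]].
  by exists u, v; split; first by move: uv; rewrite inE.
by exists (u, v); rewrite ?inE.
Qed.

Lemma ends_cases u v : adj u v -> forall r t, [set r; t] = [set u; v] ->
  (r = u /\ t = v) \/ (r = v /\ t = u).
Proof.
move=> uv r t /setP H; have := H r; have := H t; have := H u; have := H v.
have uNv : u != v by apply: contraTneq uv => ->; rewrite irr.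
rewrite !inE !eqxx !orbT.
move=> vE uE /esym/orP[]/eqP tE /esym/orP[]/eqP rE; [|by right|by left|].
- by move: vE; rewrite tE rE orbb eq_sym (negbTE uNv).
- by move: uE; rewrite tE rE orbb (negbTE uNv).
Qed.

(** Only the edges at v contribute, and these correspond to the inputs of v; by
    reversibility each may be oriented so that v comes first. *)
Lemma pair_form_diff Q P v x a b : reversible Q ->
  pair_form Q P (upd x v a) - pair_form Q P (upd x v b) =
  \sum_(u in input_set adj v) (Q v a (cell x u) - Q v b (cell x u))
  + (P v a - P v b).
Proof.
move=> Qr; rewrite /pair_form opprD addrACA -!sumrB; congr (_ + _); last first.
  rewrite (bigD1 v) //= !cell_upd_eq big1 ?addr0 // => u uv.
  by rewrite !cell_upd_neq // subrr.
rewrite (bigID (fun e : {set V} => v \in e)) /= addrC big1 ?add0r; last first.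
  move=> e /andP[eE]; rewrite -{1}(ori eE) !inE negb_or => /andP[vr vt].
  by rewrite !cell_upd_neq 1?eq_sym // subrr.
have starE : [set e in edges adj | v \in e]
    = [set [set v; u] | u in input_set adj v].
  apply/setP => e; rewrite inE; apply/andP/imsetP.
    move=> [/edgesP[u [w [uw ->]]]]; rewrite !inE => /orP[]/eqP ->.
      by exists w; rewrite // inE sym.
    by exists u; rewrite ?inE // finset.setUC.
  move=> [u]; rewrite inE => uv ->; split; last by rewrite !inE eqxx.
  by apply/edgesP; exists v, u; rewrite sym.
rewrite (eq_bigl (fun e => e \in [set [set v; u] | u in input_set adj v]));
  last by move=> e; rewrite -starE inE.
rewrite big_imset /=; last first.
  move=> u1 u2; rewrite !inE => u1v u2v /setP/(_ u1); rewrite !inE eqxx orbT.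
  move=> /esym/orP[/eqP u1E|/eqP //]; by rewrite u1E irr in u1v.
apply: eq_bigr => u; rewrite inE => uv.
have uNv : u != v by apply: contraTneq uv => ->; rewrite irr.
set e := [set v; u].
have eE : e \in edges adj by apply/edgesP; exists v, u; rewrite sym.
have vu : adj v u by rewrite sym.
have [[-> ->]|[-> ->]] := ends_cases vu (ori eE).
  by rewrite !cell_upd_eq !cell_upd_neq.
by rewrite !cell_upd_eq !cell_upd_neq // !(Qr u v).
Qed.

Lemma pair_form_local_differences Q P f : reversible Q ->
  (forall v w, degree adj v = degree adj w -> Q v = Q w /\ P v = P w) ->
  f =1 pair_form Q P -> local_differences adj f.
Proof.
move=> Qr QP fE v w x y E a b; rewrite !fE !pair_form_diff //.
have sumE (z : config R V k) v' (G : 'rV[R]_k -> R) :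
    \sum_(u in input_set adj v') G (cell z u) = \sum_(c <- inputs adj z v') G c.
  by rewrite big_map big_enum.
have [<- <-] : Q v = Q w /\ P v = P w.
  by apply: QP; rewrite -(size_inputs adj x) (perm_size E) size_inputs.
by rewrite (sumE _ _ (fun c => Q v a c - Q v b c))
  (sumE _ _ (fun c => Q v a c - Q v b c)) (perm_big _ E).
Qed.

End PairForm.

(** * Mixed differences *)

Section Differences.
Variables (R : realType) (V : finType) (k : nat).
Implicit Types (x y : config R V k) (a b c : 'rV[R]_k) (u v w : V).
Implicit Types (f : config R V k -> R).

(** Increments are taken from the base state 0, the same for all cells, which
    normalises the decomposition obtained from them. *)
Definition incr v a f x := f (upd x v a) - f (upd x v 0).

Lemma incrC u v a b f : u != v -> incr u b (incr v a f) = incr v a (incr u b f).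
Proof.
move=> uv; apply/funext => x; rewrite /incr !(@updC _ _ _ x u v) //.
ring.
Qed.

Lemma incr_cst f u b x : (forall y, f y = 0) -> incr u b f x = 0.
Proof. by move=> f0; rewrite /incr !f0 subrr. Qed.

Lemma incr_same f v a b x : incr v b (incr v a f) x = 0.
Proof. by rewrite /incr !upd_upd subrr. Qed.

Lemma incr0 f v x : incr v 0 f x = 0.
Proof. exact: subrr. Qed.

(** Each increment of f is constant, being invariant in every cell, so f has
    the same increments as the sum on the right. *)
Lemma separable f :
  (forall u v b c x, u != v -> incr u b (incr v c f) x = 0) ->
  forall x, f x = f 0 + \sum_u incr u (cell x u) f 0.
Proof.
move=> f2 x.
have incr_const v c y : incr v c f y = incr v c f 0.
  apply: (@eq_upd_cst _ _ _ (incr v c f)) => u z b.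
  have [->|uv] := eqVneq u v; first by rewrite /incr !upd_upd.
  by apply/eqP; rewrite -subr_eq0; apply/eqP; exact: f2.
pose F y := f y - \sum_u incr u (cell y u) f 0.
have /eqP : F x = F 0.
  apply: (@eq_upd_cst _ _ _ F) => v y a.
  have sumE : \sum_u incr u (cell (upd y v a) u) f 0 =
      incr v a f 0 + \sum_u incr u (cell (upd y v 0) u) f 0.
    rewrite (bigD1 v) //= [in RHS](bigD1 v) //= !cell_upd_eq incr0 add0r.
    by congr (_ + _); apply: eq_bigr => u uv; rewrite !cell_upd_neq.
  by rewrite /F sumE -(incr_const v a y) {1}/incr; ring.
rewrite /F [X in _ == _ - X]big1 ?subr0;
  last by move=> u _; rewrite cell0 incr0.
by rewrite subr_eq => /eqP.
Qed.

End Differences.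

(** * Decomposition into pair interactions *)

Section Decomposition.
Variables (R : realType) (V : finType) (adj : rel V) (k : nat).
Implicit Types (x y : config R V k) (a b c : 'rV[R]_k) (u v w : V).
Variable f : config R V k -> R.
Hypotheses (sym : symmetric adj) (irr : irreflexive adj)
  (LD : local_differences adj f).

Let adj_neq u v : adj u v -> u != v.
Proof. by apply: contraTneq => ->; rewrite irr. Qed.

Lemma incr_local v a x y :
  (forall u, adj u v -> cell x u = cell y u) -> incr v a f x = incr v a f y.
Proof.
move=> xy; apply: LD; apply: (@perm_inputs _ _ _ _ 1%g) => u; rewrite perm1 //.
by move/xy.
Qed.

Lemma incr2_nonadj u v a b x : ~~ adj u v -> incr u b (incr v a f) x = 0.
Proof.
move=> uv; apply/eqP; rewrite subr_eq0; apply/eqP; apply: incr_local => w wv.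
by rewrite !cell_upd_neq //; apply: contraNneq uv => <-.
Qed.

(** The absence of a three-body interaction between v, u1 and u2. *)
Definition flat v u1 u2 : Prop :=
  forall a b c x, incr u1 b (incr u2 c (incr v a f)) x = 0.

Lemma flat_nonadj v u1 u2 : u1 != v -> u2 != v -> ~~ adj u1 u2 -> flat v u1 u2.
Proof.
move=> u1v u2v u12 a b c x; rewrite (incrC _ _ _ u2v) (incrC _ _ _ u1v).
by apply: incr_cst => y; exact: incr2_nonadj.
Qed.

Lemma flat_rot v u1 u2 : u1 != v -> u2 != v -> u1 != u2 ->
  flat v u1 u2 -> flat u1 v u2.
Proof.
move=> u1v u2v u12 H a b c x.
have [vu1 vu2 u21] : [/\ v != u1, v != u2 & u2 != u1] by split; rewrite eq_sym.
by rewrite (incrC a c f u21) (incrC a b _ vu1) (incrC c b f vu2).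
Qed.

Definition relabel (s : {perm V}) x : config R V k :=
  of_cells (fun u => cell x (s u)).

Lemma upd_relabel s x u b : upd (relabel s x) u b = relabel s (upd x (s u) b).
Proof.
apply: eq_cells => w; rewrite cell_upd !cell_of_cells.
by rewrite (inj_eq perm_inj).
Qed.

(** A permutation of the inputs of v does not change the increments at v, so it
    transports the vanishing of their mixed differences. *)
Lemma flat_perm (s : {perm V}) v u1 u2 : (forall u, adj (s u) v = adj u v) ->
  flat v u1 u2 -> flat v (s u1) (s u2).
Proof.
move=> sE H a b c x.
have incr_relabel g h u b' y : (forall z, g (relabel s z) = h z) ->
    incr u b' g (relabel s y) = incr (s u) b' h y.
  by move=> gh; rewrite /incr !upd_relabel !gh.
rewrite -(H a b c (relabel s x)); apply/esym/incr_relabel => y.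
apply: incr_relabel => z; apply/LD/(@perm_inputs _ _ _ _ s) => // u _.
by rewrite cell_of_cells.
Qed.

Lemma adj_tperm v u1 u2 u :
  adj u1 v -> adj u2 v -> adj (tperm u1 u2 u) v = adj u v.
Proof. by case: tpermP => [-> -> ->|-> -> ->|]. Qed.

(** Two transpositions of inputs take u1, u2 to w1, w2: the first one sends u1
    to w1, the second one sends the image of u2 to w2 and fixes w1. *)
Lemma flat_transfer v u1 u2 w1 w2 : adj u1 v -> adj u2 v -> u1 != u2 ->
  adj w1 v -> adj w2 v -> w1 != w2 -> flat v u1 u2 -> flat v w1 w2.
Proof.
move=> u1v u2v u12 w1v w2v w12 H.
pose u2' := tperm u1 w1 u2.
have u2'v : adj u2' v by rewrite adj_tperm.
have w1u2' : u2' != w1.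
  by rewrite /u2' -{2}(tpermL u1 w1) (inj_eq perm_inj) eq_sym.
have H1 : flat v w1 u2'.
  rewrite -{1}(tpermL u1 w1); apply: flat_perm => // u; exact: adj_tperm.
have -> : w1 = tperm u2' w2 w1 by rewrite tpermD // eq_sym.
rewrite -{2}(tpermL u2' w2); apply: flat_perm => // u; exact: adj_tperm.
Qed.

Hypotheses (conn : forall u v, connect adj u v) (incomplete : ~ all_to_all adj).

Lemma adj_closed_full (B : V -> Prop) :
  (forall u v, adj u v -> B u -> B v) -> forall u v, B u -> B v.
Proof.
move=> BP u v; have /connectP[p] := conn u v.
elim: p u => [|w p IH] u /= => [_ -> //|/andP[uw pw] vE Bu].
exact: (IH w pw vE (BP _ _ uw Bu)).
Qed.

(** Otherwise v and its inputs would be closed under adjacency, hence be the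
    whole graph, which would be complete. *)
Lemma clique_exit v :
  (forall u1 u2, adj u1 v -> adj u2 v -> u1 != u2 -> adj u1 u2) ->
  exists w w', [/\ adj w v, adj w' w, w' != v & ~~ adj w' v].
Proof.
move=> clique; apply: contrapT => no; apply: incomplete.
have full : forall u, u = v \/ adj u v.
  move=> u; apply: (@adj_closed_full (fun u => u = v \/ adj u v) _ v);
    last by left.
  move=> w w' ww' [wv|wv]; first by right; rewrite sym -wv.
  have [->|w'v] := eqVneq w' v; [by left|right].
  apply: contrapT => /negP nw'v; apply: no.
  by exists w, w'; split; rewrite // sym.
move=> u1 u2 u12; have [u1E|u1v] := full u1; have [u2E|u2v] := full u2.
- by move: u12; rewrite u1E u2E eqxx.
- by rewrite u1E sym.
- by rewrite u2E.
- exact: clique.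
Qed.

(** If all inputs of v are joined to one another, some input w of v has an
    input outside the clique that they form with v. Then w has two inputs that
    are not joined, so the third differences at w vanish, and those that
    involve v are third differences at v. *)
Lemma flat_inputs v u1 u2 : adj u1 v -> adj u2 v -> u1 != u2 -> flat v u1 u2.
Proof.
move=> u1v u2v u12.
(* Two inputs that are not joined settle all pairs of inputs of w. *)
have split_case w w1 w2 t1 t2 :
    adj w1 w -> adj w2 w -> w1 != w2 -> ~~ adj w1 w2 ->
    adj t1 w -> adj t2 w -> t1 != t2 -> flat w t1 t2.
  move=> w1w w2w w12 Nw12 t1w t2w t12; apply: (flat_transfer w1w w2w) => //.
  by apply: flat_nonadj => //; exact: adj_neq.
case: (pselect (forall u1 u2, adj u1 v -> adj u2 v -> u1 != u2 -> adj u1 u2)).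
  move=> clique; have [w [w' [wv w'w w'v Nw'v]]] := clique_exit clique.
  have [u [uv uw]] : exists u, adj u v /\ u != w.
    by have [<-|] := eqVneq u1 w; [exists u2; rewrite eq_sym|exists u1].
  apply: (@flat_transfer v w u) => //; first by rewrite eq_sym.
  (* v and w' are inputs of w that are not joined, and v, u are inputs of w. *)
  apply: (@flat_rot w v u) => //; try by rewrite eq_sym adj_neq.
  apply: (@split_case w v w') => //;
    rewrite ?(eq_sym v) ?(adj_neq uv) // 1?(sym v) //.
  by apply: clique; rewrite // eq_sym.
move=> /existsNP[t1 /existsNP[t2 /not_implyP[t1v /not_implyP[t2v
  /not_implyP[t12 /negP Nt12]]]]].
exact: (@split_case v t1 t2).
Qed.

Definition self_term v a : R := incr v a f 0.

(** For an isolated cell the default value v makes its interaction vanish. *)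
Definition some_input v : V := odflt v [pick u | adj u v].

(** The second mixed difference at 0 along the edge between v and one of its
    inputs; all inputs of v give the same function ([interactionE]). *)
Definition interaction v a b : R := incr (some_input v) b (incr v a f) 0.

Lemma inputs_upd0 u v b : adj u v ->
  perm_eq (inputs adj (upd 0 u b) v) (b :: nseq (degree adj v).-1 0).
Proof.
move=> uv; have uI : u \in enum (input_set adj v) by rewrite mem_enum inE.
have uniqI : uniq (enum (input_set adj v)) by exact: enum_uniq.
rewrite (permPl (perm_map _ (perm_to_rem uI))) /= cell_upd_eq perm_cons.
have /all_pred1P -> : all (pred1 0)
    [seq cell (upd 0 u b) i | i <- rem u (enum (input_set adj v))].
  apply/allP => _ /mapP[w + ->].
  rewrite (mem_rem_uniq u uniqI) inE => /andP[wu _].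
  by rewrite /= cell_upd_neq // cell0.
by rewrite size_map size_rem // -cardE.
Qed.

Lemma inputs0 v : inputs adj (0 : config R V k) v = nseq (degree adj v) 0.
Proof.
rewrite -(size_inputs adj (0 : config R V k)); apply/all_pred1P/allP.
by move=> _ /mapP[w _ ->]; rewrite /= cell0.
Qed.

(** A single input in state b and all others at 0: this multiset of inputs
    depends only on b and the degree. *)
Lemma interaction_degree u v w w' a b : adj u v -> adj w' w ->
  degree adj v = degree adj w ->
  incr u b (incr v a f) 0 = incr w' b (incr w a f) 0.
Proof.
move=> uv ww' dE; rewrite /incr; congr (_ - _); apply: LD.
  by rewrite (permPl (inputs_upd0 _ uv)) dE perm_sym inputs_upd0.
by rewrite (permPl (inputs_upd0 _ uv)) dE perm_sym inputs_upd0.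
Qed.

Lemma interactionE u v a b :
  adj u v -> interaction v a b = incr u b (incr v a f) 0.
Proof.
move=> uv; rewrite /interaction /some_input; case: pickP => [w wv|/(_ u)].
  exact: interaction_degree.
by rewrite uv.
Qed.

Lemma degree_gt0 u v : adj u v -> (0 < degree adj v)%N.
Proof. by move=> uv; apply/card_gt0P; exists u; rewrite inE. Qed.

Lemma eq_interaction v w : degree adj v = degree adj w ->
  interaction v = interaction w.
Proof.
move=> dE; apply/funext => a; apply/funext => b.
rewrite /interaction /some_input.
case: (pickP (adj^~ v)) => [u uv|v0]; case: (pickP (adj^~ w)) => [u' uw|w0] /=.
- exact: interaction_degree.
- by have := degree_gt0 uv; rewrite dE => /card_gt0P[u']; rewrite inE w0.
- by have := degree_gt0 uw; rewrite -dE => /card_gt0P[u]; rewrite inE v0.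
- by rewrite !incr_same.
Qed.

Lemma eq_self_term v w :
  degree adj v = degree adj w -> self_term v = self_term w.
Proof.
by move=> dE; apply/funext => a; apply: LD; rewrite !inputs0 dE.
Qed.

(** Mixed differences commute. *)
Lemma interaction_reversible : reversible adj interaction.
Proof.
move=> u v a b uv; have vu : adj v u by rewrite sym.
by rewrite (interactionE _ _ vu) (interactionE _ _ uv) incrC // adj_neq.
Qed.

(** With no three-body interactions the increment at v is separable in the
    inputs of v. *)
Lemma incr_decomposition v a x :
  incr v a f x
  = self_term v a + \sum_(u in input_set adj v) interaction v a (cell x u).
Proof.
rewrite (@separable _ _ _ (incr v a f)) => [|u w b c y uw].
  congr (_ + _); rewrite [RHS]big_mkcond; apply: eq_bigr => u _; rewrite inE.
  case: ifP => [uv|/negbT uv]; first by rewrite (interactionE _ _ uv).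
  exact: incr2_nonadj.
have [wv|/incr2_nonadj wv] := boolP (adj w v); last first.
  by apply: incr_cst => z; exact: wv.
have [uv|uv] := boolP (adj u v); first exact: flat_inputs.
by rewrite incrC //; apply: incr_cst => z; exact: incr2_nonadj.
Qed.

(** Both sides have the same increments at every cell and the same value at
    0. *)
Lemma pair_decomposition rho tau : orientation adj rho tau ->
  forall x, f x = f 0 + pair_form adj rho tau interaction self_term x.
Proof.
move=> ori x; set g := pair_form _ _ _ _ _.
have i00 v b : interaction v 0 b = 0 by apply: incr_cst => y; exact: incr0.
have -> : f x = f x - g x + g x by rewrite subrK.
congr (_ + _); rewrite (@eq_upd_cst _ _ _ (fun y => f y - g y)) => [|v y a].
  rewrite /g /pair_form !big1 ?addr0 ?subr0 // => e _; rewrite !cell0 ?i00 //.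
  exact: incr0.
have : f (upd y v a) - f (upd y v 0) = g (upd y v a) - g (upd y v 0).
  rewrite -[LHS]/(incr v a f y) incr_decomposition /g.
  rewrite pair_form_diff //; last exact: interaction_reversible.
  rewrite [self_term v 0]incr0 subr0 addrC; congr (_ + _).
  by apply: eq_bigr => u _; rewrite i00 subr0.
by move=> /eqP; rewrite subr_eq => /eqP ->; ring.
Qed.

End Decomposition.

(** * Smoothness of the summands *)

Section Smoothness.
Variables (R : realType) (V : finType) (adj : rel V) (k : nat).
Variable f : config R V k -> R.
Hypothesis sf : smooth f.

Lemma smooth_self_term v : smooth (self_term f v).
Proof.
apply: smoothB; last exact: smooth_cst.
apply: smooth_affine sf; apply: continuous_affine_upd.
  exact: continuous_affine_cst.
by split; [move=> a; exact: cvg_id|exists id].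
Qed.

Lemma smooth_interaction v :
  smooth (fun p : 'rV[R]_k * 'rV[R]_k => interaction adj f v p.1 p.2).
Proof.
have fstP : continuous_affine (fst : 'rV[R]_k * 'rV[R]_k -> 'rV[R]_k).
  by split; [move=> p; exact: cvg_fst|exists fst].
have sndP : continuous_affine (snd : 'rV[R]_k * 'rV[R]_k -> 'rV[R]_k).
  by split; [move=> p; exact: cvg_snd|exists snd].
have cstP (F : normedModType R) (y : F) :=
  @continuous_affine_cst _ ('rV[R]_k * 'rV[R]_k)%type F y.
by apply: smoothB; apply: smoothB; apply: smooth_affine sf;
  do !apply: continuous_affine_upd.
Qed.

End Smoothness.

(** * Interactions as a two-colouring of the graph *)

Section Colouring.
Variables (R : realType) (V : finType) (adj : rel V) (k : nat).
Hypotheses (sym : symmetric adj) (conn : forall u v, connect adj u v).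
Variable Q : V -> 'rV[R]_k -> 'rV[R]_k -> R.
Hypothesis Qr : reversible adj Q.

Lemma reversible_adj u v : adj u v -> Q v = (fun a b => Q u b a).
Proof.
move=> uv; apply/funext => a; apply/funext => b.
exact: Qr (eq_trans (sym v u) uv).
Qed.

Lemma reversible_bipartite (U : {set V}) w :
  (forall u v, adj u v -> (u \in U) = (v \notin U)) -> w \in U ->
  forall v, Q v = if v \in U then Q w else fun a b => Q w b a.
Proof.
move=> UP wU v.
apply: (@adj_closed_full _ _ conn
  (fun v => Q v = if v \in U then Q w else fun a b => Q w b a) _ w);
  last by rewrite wU.
move=> u v' uv; rewrite (reversible_adj uv) (UP _ _ uv) => ->.
by case: (v' \in U).
Qed.

(** If Q w is not symmetric, the vertices v with Q v = Q w and those for which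
    Q v is the transpose of Q w form a bipartition. *)
Lemma reversible_nonbipartite w : ~ bipartite adj ->
  (forall v, Q v = Q w) /\ forall a b, Q w a b = Q w b a.
Proof.
move=> nb.
have [wS|wNS] := pselect (Q w = fun a b => Q w b a).
  split=> [v|a b]; last by rewrite {1}wS.
  apply: (@adj_closed_full _ _ conn (fun v => Q v = Q w) _ w) => // u u' uu' uE.
  by rewrite (reversible_adj uu') uE.
exfalso; apply: nb.
pose U := [set v | `[< Q v = Q w >]].
have UP v : Q v = Q w \/ Q v = fun a b => Q w b a.
  apply: (@adj_closed_full _ _ conn
    (fun v => Q v = Q w \/ Q v = fun a b => Q w b a) _ w); last by left.
  by move=> u u' uu' [uE|uE]; rewrite (reversible_adj uu') uE; [right|left].
exists U, (~: U); split; first by rewrite finset.setUCr.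
  by rewrite finset.disjoints_subset finset.setCK.
have inU v : v \in U <-> Q v = Q w by rewrite inE; split=> /asboolP.
move=> u v uv; have := reversible_adj uv.
rewrite [v \in ~: U]inE [u \in ~: U]inE.
case: (UP u) => uE; rewrite uE => vE; [left|right]; split; try exact/inU.
  by apply/negP => /inU; rewrite vE => /esym.
by apply/negP => /inU; rewrite uE => /esym.
Qed.

End Colouring.

(** * The two directions of the characterisation *)

Section AdmissibleForms.
Variables (R : realType) (V : finType) (adj : rel V) (k : nat).
Variables (rho tau : {set V} -> V).
Hypotheses (graph_adj : cell_graph adj) (ori : orientation adj rho tau).

Let irr : irreflexive adj. Proof. by case: graph_adj. Qed.
Let sym : symmetric adj. Proof. by case: graph_adj. Qed.
Let conn u v : connect adj u v. Proof. by case: graph_adj => _ _ _; apply. Qed.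

(** An edge with exactly one end in U is read from that end. A symmetric beta
    can be read from either end, and then U is the whole graph. *)
Definition pair_fun (beta : 'rV[R]_k * 'rV[R]_k -> R) (U : {set V}) v a b :=
  if v \in U then beta (a, b) else beta (b, a).

(** The interaction is either symmetric, or read from a colour class that the
    degree of a vertex determines; in both cases what a vertex sees depends
    only on its degree. *)
Lemma admissible_pair_fun (f : config R V k -> R) beta (U : {set V})
    (P : V -> 'rV[R]_k -> R) :
  smooth f ->
  Z2_invariant beta \/ ((forall u v, adj u v -> (u \in U) = (v \notin U)) /\
    (forall u v, degree adj u = degree adj v -> (u \in U) = (v \in U))) ->
  (forall u v, degree adj u = degree adj v -> P u = P v) ->
  f =1 pair_form adj rho tau (pair_fun beta U) P ->
  admissible_function adj f.
Proof.
move=> sf bU PP fE; apply: local_differences_admissible => //.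
apply: (pair_form_local_differences sym irr ori _ _ fE) => [u v a b uv|u v uv].
  rewrite /pair_fun; case: bU => [bZ|[UP _]]; last first.
    by rewrite (UP _ _ uv); case: (v \in U).
  by case: ifP; case: ifP; rewrite // (bZ a b).
split; last exact: PP.
apply/funext => a; apply/funext => b; rewrite /pair_fun.
case: bU => [bZ|[_ /(_ _ _ uv) ->]] //.
by case: ifP; case: ifP; rewrite // (bZ a b).
Qed.

(** The constant f 0 is distributed evenly over the vertices, since the forms
    sought have no constant term. *)
Definition degree_term (f : config R V k -> R) (d : nat) : 'rV[R]_k -> R :=
  if [pick v | degree adj v == d] is Some v
  then fun a => self_term f v a + f 0 / #|V|%:R else fun=> 0.

Lemma smooth_degree_term f d : smooth f -> smooth (degree_term f d).
Proof.
move=> sf; rewrite /degree_term; case: pickP => [v _|_]; last exact: smooth_cst.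
by apply: smoothD; [exact: smooth_self_term|exact: smooth_cst].
Qed.

Lemma admissible_pair_form (f : config R V k -> R) : ~ all_to_all adj ->
  admissible_function adj f -> forall x,
  f x = pair_form adj rho tau (interaction adj f)
    (fun v => degree_term f (degree adj v)) x.
Proof.
move=> incomplete af x; have LD := admissible_local_differences irr af.
rewrite (pair_decomposition sym irr LD conn incomplete ori) /pair_form addrCA.
congr (_ + _); have V0 : #|V|%:R != 0 :> R.
  by rewrite pnatr_eq0 -lt0n; case: graph_adj.
rewrite [RHS](eq_bigr (fun v => self_term f v (cell x v) + f 0 / #|V|%:R));
  last first.
  move=> v _; rewrite /degree_term; case: pickP => [w /eqP wv|/(_ v)].
    by rewrite (eq_self_term LD wv).
  by rewrite eqxx.
rewrite [RHS]big_split addrC; congr (_ + _).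
have constE (c : R) : \sum_(v : V) c = c *+ #|V|.
  by rewrite -sumr_const; apply: eq_bigl.
by rewrite constE -(mulr_natr (f 0 / _)) divfK.
Qed.

End AdmissibleForms.

Theorem theorem2p4 (R : realType) (V : finType) (adj : rel V) (k : nat)
    (graph_adj : cell_graph adj) (k_gt0 : (0 < k)%N) :
  (all_to_all adj ->
     forall f : config R V k -> R,
       admissible_function adj f <-> smooth f /\ S_invariant f)
  /\
  (~ all_to_all adj ->
     forall (rho tau : {set V} -> V) (V1 V2 Vi : {set V}),
       orientation adj rho tau ->
       (bipartite adj ->
          [/\ bipartition adj V1 V2, Vi = V1 \/ Vi = V2
            & forall e, e \in edges adj -> rho e \in Vi]) ->
     forall f : config R V k -> R, smooth f ->
       (admissible_function adj f <->
        exists (alpha : nat -> 'rV[R]_k -> R)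
               (beta : 'rV[R]_k * 'rV[R]_k -> R),
          [/\ forall d, smooth (alpha d), smooth beta &
           (bipartite adj /\
            exists gamma : nat -> 'rV[R]_k -> R,
              [/\ forall d, smooth (gamma d),
                  forall x, f x =
                    \sum_(e in edges adj | rho e \in Vi)
                       beta (cell x (rho e), cell x (tau e))
                    + \sum_(v in V1) alpha (degree adj v) (cell x v)
                    + \sum_(v in V2) gamma (degree adj v) (cell x v)
                & (exists v1 v2, [/\ v1 \in V1, v2 \in V2
                                   & degree adj v1 = degree adj v2]) ->
                  Z2_invariant beta /\
                  forall x, f x =
                    \sum_(e in edges adj)
                       beta (cell x (rho e), cell x (tau e))
                    + \sum_(v : V) alpha (degree adj v) (cell x v)])
           \/
           (~ bipartite adj /\
            Z2_invariant beta /\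
            forall x, f x =
              \sum_(e in edges adj) beta (cell x (rho e), cell x (tau e))
              + \sum_(v : V) alpha (degree adj v) (cell x v))])).
Proof.
have [V0 sym irr conn] := graph_adj.
split=> [complete f|incomplete rho tau V1 V2 Vi ori bip f sf].
  split=> [af|[sf Sf]].
    split; first by case: af.
    apply: (local_differences_S_invariant irr complete).
    exact: (admissible_local_differences irr af).
  apply: (local_differences_admissible sf).
  exact: (S_invariant_local_differences irr complete Sf).
have bipE (g : V -> R) : bipartite adj ->
    \sum_(v in V1) g v + \sum_(v in V2) g v = \sum_v g v.
  move=> /bip[[V12 dV _] _ _]; rewrite -bigU //=; apply: eq_bigl => v.
  by have /setP/(_ v) := V12; rewrite !inE.
have edgesE (g : {set V} -> R) : bipartite adj ->
    \sum_(e in edges adj | rho e \in Vi) g e = \sum_(e in edges adj) g e.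
  move=> /bip[_ _ Vi_rho]; apply: eq_bigl => e.
  by case: (boolP (e \in edges adj)) => // /Vi_rho ->.
have V2E : bipartite adj -> forall v, (v \in V2) = (v \notin V1).
  move=> /bip[[/setP VE /pred0P dV _] _ _] v.
  move: (VE v) (dV v); rewrite !inE /=.
  by case: (v \in V1); case: (v \in V2).
have ViP : bipartite adj -> forall u v, adj u v -> (u \in Vi) = (v \notin Vi).
  move=> isb; have [[_ _ VE] ViE _] := bip isb; move=> u v /VE.
  case: ViE => ->; rewrite !V2E //;
    by case: (u \in V1); case: (v \in V1) => -[[]|[]].
(* Vi is V1 or its complement, so both separate the same pairs of vertices. *)
have Vi_class : bipartite adj -> forall u v,
    ((u \in Vi) == (v \in Vi)) = ((u \in V1) == (v \in V1)).
  move=> isb u v; have [_ ViE _] := bip isb.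
  by case: ViE => -> //; rewrite !V2E // (inj_eq negb_inj).
split=> [af|[alpha [beta [sa sb H]]]].
  have LD := admissible_local_differences irr af.
  have Qr := interaction_reversible sym irr LD.
  have fE := admissible_pair_form graph_adj ori incomplete af.
  pose alpha d := degree_term adj f d.
  have sa d : smooth (alpha d) by exact: smooth_degree_term.
  have [isb|nb] := pselect (bipartite adj); last first.
    have [v0 _] : exists v0 : V, v0 \in V by apply/card_gt0P.
    have [QE Qsym] := reversible_nonbipartite sym conn Qr v0 nb.
    exists alpha, (fun p => interaction adj f v0 p.1 p.2); split=> //.
      exact: smooth_interaction.
    right; split=> //; split=> [a b|x]; first exact: Qsym.
    rewrite fE /pair_form; congr (_ + _); apply: eq_bigr => e _.
    by rewrite QE.
  have [[V12 dV VE] ViE Vi_rho] := bip isb.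
  (* A graph that is not complete and connected has an edge, so Vi is not
     empty. *)
  have [w wVi] : exists w, w \in Vi.
    apply: contrapT => Vi0; apply: incomplete => u v /eqP uv; case: uv.
    have noVi z : (z \in Vi) = false by apply/negP => zVi; apply: Vi0; exists z.
    apply: (@adj_closed_full _ _ conn (fun z => u = z) _ u) => // z z' zz' _.
    by have := ViP isb _ _ zz'; rewrite !noVi.
  have QE := reversible_bipartite sym conn Qr (ViP isb) wVi.
  pose beta (p : 'rV[R]_k * 'rV[R]_k) := interaction adj f w p.1 p.2.
  have formE x : f x =
      \sum_(e in edges adj) beta (cell x (rho e), cell x (tau e))
      + \sum_(v : V) alpha (degree adj v) (cell x v).
    rewrite fE /pair_form; congr (_ + _); apply: eq_bigr => e /Vi_rho re.
    by rewrite QE re.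
  exists alpha, beta; split=> //; first exact: smooth_interaction.
  (* The degree terms need not distinguish the parts: gamma is alpha. *)
  left; split=> //; exists alpha; split=> // [x|[v1 [v2 [v1V v2V dE]]]].
    by rewrite edgesE // -addrA bipE.
  split=> // a b; rewrite /beta /=.
  have := congr1 (fun q => q a b) (eq_interaction LD dE).
  rewrite (QE v1) (QE v2).
  have : (v1 \in Vi) != (v2 \in Vi).
    by rewrite Vi_class // v1V; move: v2V; rewrite V2E // => /negbTE ->.
  by case: (v1 \in Vi); case: (v2 \in Vi) => // _ ->.
have symmetric_form : Z2_invariant beta -> (forall x, f x =
      \sum_(e in edges adj) beta (cell x (rho e), cell x (tau e))
      + \sum_(v : V) alpha (degree adj v) (cell x v)) ->
    admissible_function adj f.
  move=> bZ fE; apply: (@admissible_pair_fun _ _ _ _ _ _ graph_adj ori f beta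
    [set: V] (fun v => alpha (degree adj v)) sf); first by left.
    by move=> u v ->.
  move=> x; rewrite fE /pair_form; congr (_ + _); apply: eq_bigr => e _.
  by rewrite /pair_fun inE.
case: H => [[isb [gamma [sg fE fE2]]]|[nb [bZ fE]]]; last exact: symmetric_form.
have [shared|disj] := pselect (exists v1 v2, [/\ v1 \in V1, v2 \in V2
                                   & degree adj v1 = degree adj v2]).
  by have [] := fE2 shared; exact: symmetric_form.
have [[V12 dV VE] ViE Vi_rho] := bip isb.
(* No degree is shared between the parts, so the degree determines the part. *)
have sameV1 u v : degree adj u = degree adj v -> (u \in V1) = (v \in V1).
  have key z z' : degree adj z = degree adj z' -> z \in V1 -> z' \in V1.
    move=> dE zV1; apply: contrapT => /negP; rewrite -V2E // => z'V2.
    by apply: disj; exists z, z'.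
  by move=> dE; apply/idP/idP; apply: key.
apply: (@admissible_pair_fun _ _ _ _ _ _ graph_adj ori f beta Vi
  (fun v => (if v \in V1 then alpha else gamma) (degree adj v)) sf).
- right; split=> [|u v dE]; first exact: ViP.
  by apply/eqP; rewrite Vi_class // (sameV1 _ _ dE).
- by move=> u v dE; rewrite (sameV1 _ _ dE) dE.
move=> x; rewrite fE edgesE // -addrA /pair_form; congr (_ + _).
  by apply: eq_bigr => e /Vi_rho re; rewrite /pair_fun re.
rewrite -bipE //; congr (_ + _); apply: eq_bigr => v; first by move=> ->.
by rewrite V2E // => /negbTE ->.
Qed.
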